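(* Let $(\mathcal{C},\mathcal{N})$ be a semiexact category and let $$A\xrightarrow{f}B\xrightarrow{g}C,\qquad A'\xrightarrow{f'}B'\xrightarrow{g'}C',\qquad a\colon A\to A',\quad b\colon B\to B',\quad c\colon C\to C'$$ be morphisms in $\mathcal{C}$ with $bf=f'a$ and $cg=g'b$. Let $S$ be the left-hand commutative square (with sides $f,a,b,f'$) and $T$ the right-hand commutative square (with sides $g,b,c,g'$). Suppose that the morphism $b$ is exact and that the compositions $gf$ and $g'f'$ are null. Then there exists a unique morphism $\Lambda\colon \mathrm{Im}\,S\to\mathrm{Ker}\,T$ such that $$r_T\, l_S=(\ker\rho_T)\,\Lambda\,(\mathrm{coker}\,\lambda_S).$$
   Context: An ideal $\mathcal{N}$ in a category $\mathcal{C}$ is a class of morphisms such that for every $f\in\mathcal{N}$ every defined composite $hfg$ is in $\mathcal{N}$; morphisms in $\mathcal{N}$ are called null. The ideal is closed if there is a class $\mathcal{O}$ of objects such that $\mathcal{N}$ consists exactly of the morphisms factoring through some object of $\mathcal{O}$. A kernel of $f\colon A\to B$ (with respect to $\mathcal{N}$) is a morphism $k=\ker f\colon \mathrm{Ker}\,f\to A$ with $fk\in\mathcal{N}$ such that every $x$ with $fx\in\mathcal{N}$ factors as $x=kx'$ for a unique $x'$; cokernels $\mathrm{coker}\,f\colon B\to\mathrm{Coker}\,f$ are defined dually. A morphism is called a kernel (cokernel) if it is a kernel (cokernel) of some morphism. $(\mathcal{C},\mathcal{N})$ is semiexact if $\mathcal{N}$ is a closed ideal and every morphism has a kernel and a cokernel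 with respect to $\mathcal{N}$. Put $\mathrm{im}\,f=\ker(\mathrm{coker}\,f)\colon\mathrm{Im}\,f\to B$ and $\mathrm{coim}\,f=\mathrm{coker}(\ker f)\colon A\to\mathrm{Coim}\,f$. Every morphism in a semiexact category factors as $f=(\mathrm{im}\,f)\,\overline{f}\,(\mathrm{coim}\,f)$ for a unique $\overline{f}\colon\mathrm{Coim}\,f\to\mathrm{Im}\,f$; $f$ is exact if $\overline f$ is an isomorphism. For the exact morphism $b$ one chooses representatives so that $\mathrm{Coim}\,b=\mathrm{Im}\,b$, $\overline b=\mathrm{id}$ and $b=(\mathrm{im}\,b)(\mathrm{coim}\,b)$. In a semiexact category, pullbacks of kernels along arbitrary morphisms and pushouts of cokernels along arbitrary morphisms exist. Lambek invariants. Let $Q$ be a commutative square with $u\colon X\to Y$ (top), $v\colon X\to Z$ (left), $w\colon Y\to W$ (right), $z\colon Z\to W$ (bottom), $wu=zv$. (1) Let $P$ be the pullback of $\mathrm{im}\,w\colon\mathrm{Im}\,w\to W$ and $\mathrm{im}\,z\colon\mathrm{Im}\,z\to W$, with projection $l_Q\colon P\to\mathrm{Im}\,w$. The morphisms $\overline w(\mathrm{coim}\,w)u\colon X\to\mathrm{Im}\,w$ and $\overline z(\mathrm{coim}\,z)v\colon X\to\mathrm{Im}\,z$ induce a unique $\lambda_Q\colon X\to P$ compatible with the projections. Put $\mathrm{Im}\,Q:=\mathrm{Coker}\,\lambda_Q$. (2) Let $N$ be the pushout of $\mathrm{coim}\,u\colon X\to\mathrm{Coim}\,u$ and $\mathrm{coim}\,v\colon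 X\to\mathrm{Coim}\,v$, with injection $r_Q\colon\mathrm{Coim}\,v\to N$. The morphisms $w(\mathrm{im}\,u)\overline u\colon\mathrm{Coim}\,u\to W$ and $z(\mathrm{im}\,v)\overline v\colon\mathrm{Coim}\,v\to W$ induce a unique $\rho_Q\colon N\to W$ compatible with the injections. Put $\mathrm{Ker}\,Q:=\mathrm{Ker}\,\rho_Q$. Thus in the claim $l_S$ has target $\mathrm{Im}\,b$ and $r_T$ has source $\mathrm{Coim}\,b$, and the composite $r_Tl_S$ is formed using the identification $\mathrm{Coim}\,b=\mathrm{Im}\,b$. *)

(* Defs.v *)
(* Plain Rocq: the definitions use only the Prelude, no library. *)
Set Implicit Arguments.
Unset Strict Implicit.
Unset Printing Implicit Defensive.

Record Category : Type := {
  Ob :> Type;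
  Hom : Ob -> Ob -> Type;
  idm : forall A : Ob, Hom A A;
  comp : forall A B D : Ob, Hom B D -> Hom A B -> Hom A D;
  comp_idl : forall (A B : Ob) (f : Hom A B), comp (idm B) f = f;
  comp_idr : forall (A B : Ob) (f : Hom A B), comp f (idm A) = f;
  comp_assoc : forall (A B D E : Ob) (h : Hom D E) (g : Hom B D) (f : Hom A B),
    comp h (comp g f) = comp (comp h g) f
}.

Arguments Hom {c} A B.
Arguments idm {c} A.
Arguments comp {c A B D} g f.

Notation "g ∘ f" := (comp g f) (at level 40, left associativity).

Definition is_iso (C : Category) (A B : C) (f : Hom A B) : Prop :=
  exists g : Hom B A, g ∘ f = idm A /\ f ∘ g = idm B.

Definition is_pullback (C : Category) (A B D P : C)
    (m : Hom A D) (n : Hom B D) (p : Hom P A) (q : Hom P B) : Prop :=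
  m ∘ p = n ∘ q /\
  forall (X : C) (x : Hom X A) (y : Hom X B), m ∘ x = n ∘ y ->
    exists! t : Hom X P, p ∘ t = x /\ q ∘ t = y.

Definition is_pushout (C : Category) (A B D P : C)
    (m : Hom D A) (n : Hom D B) (i : Hom A P) (j : Hom B P) : Prop :=
  i ∘ m = j ∘ n /\
  forall (X : C) (x : Hom A X) (y : Hom B X), x ∘ m = y ∘ n ->
    exists! t : Hom P X, t ∘ i = x /\ t ∘ j = y.

Definition MorClass (C : Category) : Type := forall A B : C, Hom A B -> Prop.

Section Semiexact.

Variables (C : Category) (null : MorClass C).

Definition is_ideal : Prop :=
  forall (A B D E : C) (g : Hom A B) (f : Hom B D) (h : Hom D E),
    null f -> null (h ∘ f ∘ g).

Definition is_closed : Prop :=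
  exists O : C -> Prop, forall (A B : C) (f : Hom A B),
    null f <->
    exists (Z : C) (p : Hom A Z) (q : Hom Z B), O Z /\ f = q ∘ p.

Definition is_kernel (A B K : C) (f : Hom A B) (k : Hom K A) : Prop :=
  null (f ∘ k) /\
  forall (X : C) (x : Hom X A), null (f ∘ x) ->
    exists! x' : Hom X K, x = k ∘ x'.

Definition is_cokernel (A B Q : C) (f : Hom A B) (q : Hom B Q) : Prop :=
  null (q ∘ f) /\
  forall (X : C) (x : Hom B X), null (x ∘ f) ->
    exists! x' : Hom Q X, x = x' ∘ q.

Definition semiexact : Prop :=
  is_ideal /\ is_closed /\
  (forall (A B : C) (f : Hom A B), exists (K : C) (k : Hom K A), is_kernel f k) /\
  (forall (A B : C) (f : Hom A B), exists (Q : C) (q : Hom B Q), is_cokernel f q).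

(* [is_image f m]: m is a representative of im f = ker (coker f). *)
Definition is_image (A B I : C) (f : Hom A B) (m : Hom I B) : Prop :=
  exists (Q : C) (q : Hom B Q), is_cokernel f q /\ is_kernel q m.

(* [is_coimage f e]: e is a representative of coim f = coker (ker f). *)
Definition is_coimage (A B J : C) (f : Hom A B) (e : Hom A J) : Prop :=
  exists (K : C) (k : Hom K A), is_kernel f k /\ is_cokernel k e.

(* A choice of representatives of im f and coim f, with the induced middle
   morphism.  Given [Fim] and [Fcoim], [Fbar] is determined by [FactorE], since
   kernels are monic and cokernels are epic. *)
Record Factorization (A B : C) (f : Hom A B) : Type := {
  Coim : C;
  Im : C;
  Fcoim : Hom A Coim;
  Fbar : Hom Coim Im;
  Fim : Hom Im B;
  FcoimP : is_coimage f Fcoim;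
  FimP : is_image f Fim;
  FactorE : f = Fim ∘ Fbar ∘ Fcoim
}.

(* In a semiexact category a factorization always exists, and invertibility of
   its middle morphism does not depend on the representatives. *)
Definition exact (A B : C) (f : Hom A B) : Prop :=
  exists F : Factorization f, is_iso (Fbar F).

(* Representatives for an exact morphism with Coim f = Im f and middle
   morphism the identity. *)
Record ExactFactorization (A B : C) (f : Hom A B) : Type := {
  ExIm : C;
  Excoim : Hom A ExIm;
  Exim : Hom ExIm B;
  ExcoimP : is_coimage f Excoim;
  EximP : is_image f Exim;
  ExactE : f = Exim ∘ Excoim
}.

Lemma exact_factorE (A B : C) (f : Hom A B) (F : ExactFactorization f) :
  f = Exim F ∘ idm (ExIm F) ∘ Excoim F.
Proof. rewrite comp_idr; exact (ExactE F). Qed.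

Definition of_exact (A B : C) (f : Hom A B) (F : ExactFactorization f) :
    Factorization f :=
  {| Coim := ExIm F; Im := ExIm F;
     Fcoim := Excoim F; Fbar := idm (ExIm F); Fim := Exim F;
     FcoimP := ExcoimP F; FimP := EximP F;
     FactorE := exact_factorE F |}.

Record Square : Type := {
  sqX : C; sqY : C; sqZ : C; sqW : C;
  top : Hom sqX sqY;
  left : Hom sqX sqZ;
  right : Hom sqY sqW;
  bottom : Hom sqZ sqW;
  square_comm : right ∘ top = bottom ∘ left
}.

(* All the choices entering the Lambek invariant Im Q = Coker lambda_Q, relative
   to representatives [Fw], [Fz] for the right and bottom sides. *)
Record LambekIm (Q : Square) (Fw : Factorization (right Q))
    (Fz : Factorization (bottom Q)) : Type := {
  pb : C;
  lQ : Hom pb (Im Fw);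
  lQ' : Hom pb (Im Fz);
  pbP : is_pullback (Fim Fw) (Fim Fz) lQ lQ';
  lambdaQ : Hom (sqX Q) pb;
  lambdaQ_right : lQ ∘ lambdaQ = Fbar Fw ∘ Fcoim Fw ∘ top Q;
  lambdaQ_bottom : lQ' ∘ lambdaQ = Fbar Fz ∘ Fcoim Fz ∘ left Q;
  ImQ : C;
  coker_lambda : Hom pb ImQ;
  coker_lambdaP : is_cokernel lambdaQ coker_lambda
}.

(* All the choices entering the Lambek invariant Ker Q = Ker rho_Q, relative to
   representatives [Fu], [Fv] for the top and left sides. *)
Record LambekKer (Q : Square) (Fu : Factorization (top Q))
    (Fv : Factorization (left Q)) : Type := {
  po : C;
  rQ' : Hom (Coim Fu) po;
  rQ : Hom (Coim Fv) po;
  poP : is_pushout (Fcoim Fu) (Fcoim Fv) rQ' rQ;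
  rhoQ : Hom po (sqW Q);
  rhoQ_top : rhoQ ∘ rQ' = right Q ∘ Fim Fu ∘ Fbar Fu;
  rhoQ_left : rhoQ ∘ rQ = bottom Q ∘ Fim Fv ∘ Fbar Fv;
  KerQ : C;
  ker_rho : Hom KerQ po;
  ker_rhoP : is_kernel rhoQ ker_rho
}.

End Semiexact.

Arguments Build_Square {C sqX sqY sqZ sqW top left right bottom}.

(* Main.v *)
(* The composite r_T l_S λ_S equals r'_T (coim g) f, which is null because f
   factors through ker g; dually ρ_T r_T l_S equals g' (im f') l'_S, which is
   null because g' factors through coker f'.  So r_T l_S descends to
   Coker λ_S, and since the ideal is closed, ρ_T annihilates the descended
   morphism too, which therefore lifts to Ker ρ_T. *)
Require Import Defs.

Set Implicit Arguments.
Unset Strict Implicit.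

Section NullMorphisms.

Variables (C : Category) (null : MorClass C).
Hypothesis hI : is_ideal null.

Lemma null_compl (A B D : C) (f : Hom A B) (h : Hom B D) :
  null f -> null (h ∘ f).
Proof.
  intros nf. rewrite <- (comp_idr (h ∘ f)). now apply hI.
Qed.

Lemma null_compr (A B D : C) (g : Hom A B) (f : Hom B D) :
  null f -> null (f ∘ g).
Proof.
  intros nf. rewrite <- (comp_idl f). now apply hI.
Qed.

Lemma kernel_mono (A B K X : C) (f : Hom A B) (k : Hom K A) (x y : Hom X K) :
  is_kernel null f k -> k ∘ x = k ∘ y -> x = y.
Proof.
  intros [nfk univ] e.
  destruct (univ X (k ∘ x)) as [t [_ tuniq]].
  - rewrite comp_assoc. now apply null_compr.
  - rewrite <- (tuniq x eq_refl). now apply tuniq.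
Qed.

Lemma cokernel_epi (A B Q X : C) (f : Hom A B) (q : Hom B Q) (x y : Hom Q X) :
  is_cokernel null f q -> x ∘ q = y ∘ q -> x = y.
Proof.
  intros [nqf univ] e.
  destruct (univ X (x ∘ q)) as [t [_ tuniq]].
  - rewrite <- comp_assoc. now apply null_compl.
  - rewrite <- (tuniq x eq_refl). now apply tuniq.
Qed.

(** Nullity of [g ∘ f] makes [f] factor through the kernel of [g], which [e] annihilates as its
    cokernel. *)
Lemma coimage_comp_null (A B J X : C) (g : Hom A B) (e : Hom A J)
    (f : Hom X A) :
  is_coimage null g e -> null (g ∘ f) -> null (e ∘ f).
Proof.
  intros [K [k [[_ univ] [nek _]]]] ngf.
  destruct (univ X f ngf) as [x [-> _]].
  rewrite comp_assoc. now apply null_compr.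
Qed.

(** Dually, [g] factors through the cokernel of [f], whose kernel is [m]. *)
Lemma comp_image_null (A B I X : C) (f : Hom A B) (m : Hom I B)
    (g : Hom B X) :
  is_image null f m -> null (g ∘ f) -> null (g ∘ m).
Proof.
  intros [Q [q [[_ univ] [nqm _]]]] ngf.
  destruct (univ X g ngf) as [x [-> _]].
  rewrite <- comp_assoc. now apply null_compl.
Qed.

(* Write [h ∘ q = v ∘ u] through a null object; then [u] kills [f], so it
   factors through [q], and [q] can be cancelled. *)
Lemma cokernel_null_cancel (A B Q X : C) (f : Hom A B) (q : Hom B Q)
    (h : Hom Q X) :
  is_closed null -> is_cokernel null f q ->
  null (h ∘ q) -> null h.
Proof.
  intros [O hO] hq nhq.
  destruct (proj1 (hO _ _ _) nhq) as [Z [u [v [OZ e]]]].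
  destruct (proj2 hq Z u) as [u' [eu _]].
  - apply hO. exists Z, (u ∘ f), (idm Z). now rewrite comp_idl.
  - apply hO. exists Z, u', v. split; [exact OZ|].
    apply (cokernel_epi hq). now rewrite e, eu, comp_assoc.
Qed.

(** Descend [h] along [q] to [s], then lift [s] through [k]; closedness serves to cancel [q] in
    [r ∘ s ∘ q]. Uniqueness holds since [k] is monic and [q] is epic. *)
Lemma unique_factor_coker_ker (A P Q K N W : C) (l : Hom A P) (q : Hom P Q)
    (r : Hom N W) (k : Hom K N) (h : Hom P N) :
  is_closed null -> is_cokernel null l q -> is_kernel null r k ->
  null (h ∘ l) -> null (r ∘ h) ->
  exists! t : Hom Q K, h = k ∘ t ∘ q.
Proof.
  intros hcl hq hk nhl nrh.
  destruct (proj2 hq _ h nhl) as [s [es _]].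
  assert (nrs : null (r ∘ s)).
  { apply (cokernel_null_cancel hcl hq).
    now rewrite <- comp_assoc, <- es. }
  destruct (proj2 hk _ s nrs) as [t [et _]].
  exists t. split.
  - now rewrite <- et.
  - intros t' et'. apply (kernel_mono hk). rewrite <- et.
    apply (cokernel_epi hq). now rewrite <- es.
Qed.

End NullMorphisms.

Unset Implicit Arguments.
Set Strict Implicit.

Theorem theorem1 (C : Category) (null : MorClass C) (hC : semiexact null)
  (A B D A' B' D' : C)
  (f : Hom A B) (g : Hom B D) (f' : Hom A' B') (g' : Hom B' D')
  (a : Hom A A') (b : Hom B B') (c : Hom D D')
  (hS : b ∘ f = f' ∘ a) (hT : c ∘ g = g' ∘ b)
  (hb : exact null b)
  (hgf : null A D (g ∘ f)) (hgf' : null A' D' (g' ∘ f'))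
  (Fb : ExactFactorization null b)
  (Ff' : Factorization null f') (Fg : Factorization null g)
  (S : LambekIm (Q := Build_Square hS) (of_exact Fb) Ff')
  (T : LambekKer (Q := Build_Square hT) Fg (of_exact Fb)) :
  exists! Lambda : Hom (ImQ S) (KerQ T),
    rQ T ∘ lQ S = ker_rho T ∘ Lambda ∘ coker_lambda S.
Proof.
  destruct hC as [hI [hcl _]].
  apply (unique_factor_coker_ker hI hcl (coker_lambdaP S) (ker_rhoP T)).
  - pose proof (lambdaQ_right S) as el.
    pose proof (proj1 (poP T)) as ep.
    cbn in *.
    (* With identity middle morphism for [b], [lQ S ∘ lambdaQ S] is [Excoim Fb ∘ f]; the pushout
       square then trades [Excoim Fb] for [Fcoim Fg]. *)
    rewrite <- comp_assoc, el, comp_idl, comp_assoc, <- ep, <- comp_assoc.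
    apply (null_compl hI).
    exact (coimage_comp_null hI (FcoimP Fg) hgf).
  - pose proof (rhoQ_left T) as er.
    pose proof (proj1 (pbP S)) as ep.
    cbn in *.
    (* Likewise [rhoQ T ∘ rQ T] is [g' ∘ Exim Fb], and the pullback square trades [Exim Fb] for
       [Fim Ff']. *)
    rewrite comp_assoc, er, comp_idr, <- comp_assoc, ep, comp_assoc.
    apply (null_compr hI).
    exact (comp_image_null hI (FimP Ff') hgf').
Qed.
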